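(* Let $k\geq 2$ be an integer and let $A$ be a finite set with $|A|\geq 2k+1$. Then the height of the poset of $k$-ary parts of maximal clones on $A$, that is, of the set $\{M\cap O_A^{(k)} : M \text{ is a maximal clone on } A\}$ ordered by inclusion, is at least $|A|-2k$. (Here height is the maximum number of elements in a chain.)
   Context: $O_A^{(n)}$ is the set of all $n$-ary operations $A^n\to A$, and $O_A=\bigcup_{n\geq 1}O_A^{(n)}$. A clone on $A$ is a subset $C\subseteq O_A$ containing all projections $(x_1,\dots,x_n)\mapsto x_i$ and closed under composition: if $g\in C$ is $n$-ary and $f_1,\dots,f_n\in C$ are $m$-ary, then $g(f_1,\dots,f_n)\in C$. A maximal clone is a clone $M\neq O_A$ such that no clone lies strictly between $M$ and $O_A$. The $k$-ary part of a clone $M$ is $M\cap O_A^{(k)}$. The height of a finite poset is understood as the number of elements of a longest chain. Known fact (Rosenberg's theorem), which may be used: for finite $A$ with $|A|\ge 3$ every clone of the form $\mathrm{Pol}\,\varrho$ (the set of all finitary operations on $A$ preserving $\varrho$, i.e. mapping tuples of $\varrho$ coordinatewise to tuples of $\varrho$), with $\varrho$ a central relation on $A$, is a maximal clone. Here a unary relation is central if it is a nonempty proper subset of $A$, and a relation $\varrho\subsetneq A^h$ with $h\geq 2$ is central if it is totally symmetric (closed under permuting coordinates), totally reflexive (contains every tuple with two equal entries), and there is $c\in A$ with $(c,x_2,\dots,x_h)\in\varrho$ for all $x_2,\dots,x_h\in A$. *)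

(* Defs.v *)
From mathcomp Require Import all_boot.
From mathcomp Require Import boolp classical_sets.

Set Implicit Arguments.
Unset Strict Implicit.
Unset Printing Implicit Defensive.

Definition operation (A : finType) (n : nat) := {ffun n.-tuple A -> A}.

Definition proj (A : finType) (n : nat) (i : 'I_n) : operation A n :=
  [ffun x : n.-tuple A => tnth x i].

Definition comp_op (A : finType) (n m : nat)
    (g : operation A n) (f : 'I_n -> operation A m) : operation A m :=
  [ffun x : m.-tuple A => g [tuple f i x | i < n]].

(* An operation bundled with its arity; arity 0 is excluded only by [O_]. *)
Definition finitary (A : finType) := {n : nat & operation A n}.

Definition bundle (A : finType) (n : nat) (f : operation A n) : finitary A :=
  Tagged (operation A) f.

Definition O_ (A : finType) : set (finitary A) :=
  [set f : finitary A | 0 < tag f]%classic.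
Arguments O_ : clear implicits.

(* In the closure condition n, m >= 1 is automatic, since C is included in
   [O_ A]. *)
Definition is_clone (A : finType) (C : set (finitary A)) : Prop :=
  [/\ (C `<=` O_ A)%classic,
      forall (n : nat) (i : 'I_n), C (bundle (proj A i)) &
      forall (n m : nat) (g : operation A n) (f : 'I_n -> operation A m),
        C (bundle g) -> (forall i, C (bundle (f i))) ->
        C (bundle (comp_op g f))].

Definition is_maximal_clone (A : finType) (M : set (finitary A)) : Prop :=
  [/\ is_clone M, M <> O_ A &
      ~ exists C : set (finitary A),
          [/\ is_clone C, (M `<` C)%classic & (C `<` O_ A)%classic]].

Definition arity_part (A : finType) (k : nat) (M : set (finitary A)) :
    {set operation A k} :=
  [set f : operation A k | `[< M (bundle f) >]]%SET.

Definition maximal_clone_parts (A : finType) (k : nat) :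
    {set {set operation A k}} :=
  [set X : {set operation A k} |
     `[< exists2 M, is_maximal_clone M & X = arity_part k M >]]%SET.

Definition is_chain (T : finType) (S : {set {set T}}) : bool :=
  [forall X in S, forall Y in S, (X \subset Y) || (Y \subset X)].

(* Height of the family P ordered by inclusion: the number of elements (not of
   covering steps) of a longest chain. *)
Definition height (T : finType) (P : {set {set T}}) : nat :=
  \max_(S : {set {set T}} | (S \subset P) && is_chain S) #|S|.

(* Main.v *)
Require Import Defs.
From mathcomp Require Import boolp classical_sets.
From mathcomp Require Import all_boot.

(** Fix [c] in [A] and, for each [h], let [star c h] be the central relation of
    all [h]-tuples that contain [c] or have a repeated entry. Membership of a
    [k]-tuple of columns in [star c h] is witnessed by at most [2 * k] rows, so
    for [h >= 2 * k] a violation of [star c h.+1] by a [k]-ary operation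
    restricts to a violation of [star c h]; hence the [k]-ary parts of
    [Pol (star c h)], [2 * k <= h < #|A|], form an increasing chain, and it is
    strict because of an essentially unary operation. Maximality of
    [Pol (star c h)] is proved directly: from one operation violating
    [star c h] one gets operations sending any [h] distinct points out of
    [star c h], and every operation [g] factors through these by an operation
    preserving [star c h]. *)

Set Implicit Arguments.
Unset Strict Implicit.
Unset Printing Implicit Defensive.

Definition preserves (A : finType) h (rho : ('I_h -> A) -> bool) n
    (f : operation A n) : Prop :=
  forall r : 'I_n -> 'I_h -> A, (forall j, rho (r j)) ->
    rho (fun i => f [tuple r j i | j < n]).

Definition Pol (A : finType) h (rho : ('I_h -> A) -> bool) :
    set (finitary A) :=
  [set f : finitary A | 0 < tag f /\ preserves rho (tagged f)]%classic.

Lemma Pol_clone (A : finType) h (rho : ('I_h -> A) -> bool) :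
  is_clone (Pol rho).
Proof.
split=> [f [] //|n i|n m g f [n0 gP] fP].
  split=> [|r rP] /=; first by case: n i => [[]|].
  suff -> : (fun l => proj A i [tuple r j l | j < n]) = r i by [].
  by apply/funext => l; rewrite ffunE tnth_mktuple.
split=> [|r rP] /=; first by case: (fP (Ordinal n0)).
have -> : (fun l => comp_op g f [tuple r j l | j < m]) =
          (fun l => g [tuple f i [tuple r j l | j < m] | i < n]).
  by apply/funext => l; rewrite ffunE.
by apply: (gP (fun i l => f i [tuple r j l | j < m])) => i; apply: (fP i).2.
Qed.

(** A single count replaces the disjunction [r] hits [c] or repeats a value, so that an operation
    with few values other than [c] preserves the relation at once. For [h = 1] this is the unary
    central relation {c}. *)
Definition star (A : finType) (c : A) h (r : 'I_h -> A) : bool :=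
  #|[set r i | i : 'I_h] :\ c| < h.

Section Star.
Variables (A : finType) (c : A).

Lemma starPn h (r : 'I_h -> A) :
  reflect (injective r /\ forall i, r i != c) (~~ star c r).
Proof.
rewrite /star -leqNgt; apply: (iffP idP) => [le_h|[r_inj r_c]]; last first.
  suff -> : [set r i | i : 'I_h] :\ c = [set r i | i : 'I_h].
    by rewrite card_imset // card_ord.
  apply/setP => x; rewrite !inE andb_idl // => /imsetP[i _ ->]; exact: r_c.
have le_im : #|[set r i | i : 'I_h]| <= h.
  by rewrite -[leqRHS]card_ord; apply: leq_imset_card.
split=> [|i].
  apply: in2T; apply/imset_injP; rewrite eqn_leq leq_imset_card card_ord.
  by rewrite (leq_trans le_h) // subset_leq_card // subD1set.
apply: contraTneq le_h => ri; rewrite -ltnNge (leq_trans _ le_im) //.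
by rewrite [leqRHS](cardsD1 c) -ri imset_f.
Qed.

Lemma starP h (r : 'I_h -> A) :
  reflect (exists p q, r p = c \/ p != q /\ r p = r q) (star c r).
Proof.
apply: (iffP idP) => [sr|[p [q pqP]]].
  apply: contraPP sr => npq; apply/negP/starPn; split=> [p q rpq|p].
    by apply: contra_notP npq => /eqP npq; exists p, q; right.
  by apply: contra_notN npq => /eqP rp; exists p, p; left.
apply/negPn/negP => /starPn[r_inj r_c]; case: pqP => [/eqP|[npq /r_inj pq]].
  exact/negP/r_c.
by rewrite pq eqxx in npq.
Qed.

Lemma preserves_star_image h n (f : operation A n) :
  #|[set f x | x : n.-tuple A] :\ c| < h -> preserves (@star A c h) f.
Proof.
move=> lt_h r _; apply: leq_ltn_trans lt_h; apply/subset_leq_card/setSD.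
by apply/subsetP => _ /imsetP[i _ ->]; apply: imset_f.
Qed.

Lemma preserves_star_succ h k (f : operation A k) : 2 * k <= h ->
  preserves (@star A c h) f -> preserves (@star A c h.+1) f.
Proof.
move=> le_kh fP r rP; apply/negPn/negP => /starPn[f_inj f_c].
have /choice[w wP] : forall j, exists pq : 'I_h.+1 * 'I_h.+1,
    r j pq.1 = c \/ pq.1 != pq.2 /\ r j pq.1 = r j pq.2.
  by move=> j; have /starP[p [q pqP]] := rP j; exists (p, q).
(* [W] collects the witness rows, two per column, so it has at most [2 * k < h.+1] elements and
   misses some row [i0]. Deleting [i0] keeps every column in the relation, while the image stays
   injective and avoids [c]. *)
pose W := [set (w j).1 | j : 'I_k] :|: [set (w j).2 | j : 'I_k].
have /subsetPn[i0 _ i0W] : ~~ ([set: 'I_h.+1] \subset W).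
  apply: contraTN le_kh => /subset_leq_card; rewrite cardsT card_ord => le_W.
  rewrite -ltnNge (leq_trans le_W) // (leq_trans (leq_card_setU _ _)) //.
  rewrite mul2n -addnn leq_add // -[leqRHS]card_ord; exact: leq_imset_card.
have i0w j : i0 != (w j).1 /\ i0 != (w j).2.
  split; apply: contraNneq i0W => ->; apply/setUP; [left|right].
    by apply/imsetP; exists j.
  by apply/imsetP; exists j.
suff: ~~ star c (fun i => f [tuple r j (lift i0 i) | j < k]).
  move/negP; apply; apply: (fP (fun j i => r j (lift i0 i))) => j; apply/starP.
  have [/unlift_some[p pE _] /unlift_some[q qE _]] := i0w j.
  exists p, q; rewrite -pE -qE; case: (wP j) => [|[npq rpq]]; first by left.
  by right; split=> //; apply: contraNneq npq => pq; rewrite pE qE pq.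
by apply/starPn; split=> [i j /f_inj /lift_inj|i]; last exact: f_c.
Qed.

Lemma star_separating h k : 0 < h -> h < #|A| -> 0 < k ->
  exists2 f : operation A k,
    preserves (@star A c h.+1) f & ~ preserves (@star A c h) f.
Proof.
move=> h0 hA k0; pose i0 := Ordinal h0; pose j0 := Ordinal k0.
have le_h : h <= #|[set~ c]| by rewrite cardsC1 -ltnS (ltn_predK hA).
pose e (i : 'I_h) := enum_val (widen_ord le_h i).
have e_inj : injective e by move=> i j /enum_val_inj/(congr1 val) /= /val_inj.
have e_c i : e i != c by have := enum_valP (widen_ord le_h i); rewrite !inE.
pose T := [set e i | i : 'I_h].
(* In its first argument, [f] is a retraction onto the [h]-element set [T], which avoids [c]: too
   few values to violate arity [h.+1]. *)
pose f : operation A k :=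
  [ffun x => if tnth x j0 \in T then tnth x j0 else e i0].
exists f.
  apply: preserves_star_image; rewrite ltnS.
  suff le_T : [set f x | x : k.-tuple A] \subset T.
    rewrite (leq_trans (subset_leq_card (subset_trans (subD1set _ _) le_T))) //.
    by rewrite card_imset // card_ord.
  apply/subsetP => _ /imsetP[x _ ->]; rewrite ffunE; case: ifP => // _.
  exact: imset_f.
(* Every column is [e] with its entry at [i0] replaced by [c]; as [f] sends [c] to [e i0], the image
   is [e] itself. *)
move=> /(_ (fun _ i => if i == i0 then c else e i)).
have sr (j : 'I_k) : star c (fun i => if i == i0 then c else e i).
  by apply/starP; exists i0, i0; left; rewrite eqxx.
move=> /(_ sr); apply/negP/starPn.
suff fE i : f [tuple if i == i0 then c else e i | j < k] = e i.
  by split=> [i j|i]; rewrite !fE //; apply: e_inj.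
rewrite ffunE tnth_mktuple; case: eqP => [->|_]; last by rewrite imset_f.
by case: ifP => // /imsetP[j _ cE]; have := e_c j; rewrite -cE eqxx.
Qed.

(** The values at [x] of all [n]-ary members of [C] determine [x], hence [g x]. The map [t]
    recovering [g x] from them preserves [star c h], because any [h] distinct points are sent by
    some member of [C] to distinct values other than [c]. *)
Lemma clone_with_violation_full h (C : set (finitary A)) m (f : operation A m) :
  is_clone C -> (Pol (@star A c h) `<=` C)%classic -> C (bundle f) ->
  ~ preserves (@star A c h) f -> (O_ A `<=` C)%classic.
Proof.
move=> [CO Cproj Ccomp] PolC Cf nf [n g]; rewrite /O_ /= => n0.
have [r rP /starPn[fr_inj fr_c]] : exists2 r : 'I_m -> 'I_h -> A,
    forall j, star c (r j) & ~~ star c (fun i => f [tuple r j i | j < m]).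
  apply: contra_notP nf => nr r rP; apply/negPn/negP => nf; apply: nr.
  by exists r.
have sep (y : 'I_h -> n.-tuple A) : injective y ->
    exists2 u : operation A n, C (bundle u) &
      ~~ star c (fun i => u (y i)).
  move=> y_inj.
  (* Apart from [c], [v j] takes only values of the column [r j], which lies in the relation; so
     [v j] is in [Pol (star c h)]. *)
  pose v j : operation A n :=
    [ffun x => if [pick i | y i == x] is Some i then r j i else c].
  have vE j i : v j (y i) = r j i.
    rewrite ffunE; case: pickP => [i' /eqP/y_inj-> //|/(_ i)].
    by rewrite eqxx.
  exists (comp_op f v).
    apply: Ccomp => // j; apply: PolC; split=> //.
    apply: preserves_star_image; apply: leq_ltn_trans (rP j).
    apply/subset_leq_card/subsetP => x; rewrite !inE.
    case/andP=> xc /imsetP[z _ xE]; rewrite xc xE; move: xc; rewrite xE ffunE.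
    by case: pickP => [i _ _|_]; rewrite ?eqxx // imset_f.
  suff -> : (fun i => comp_op f v (y i)) = fun i => f [tuple r j i | j < m].
    by apply/starPn.
  apply/funext => i; rewrite ffunE; congr (f _).
  by apply: eq_from_tnth => j; rewrite !tnth_mktuple vE.
pose U := [set u : operation A n | `[< C (bundle u) >]].
have UP u : C (bundle u) -> u \in U by move=> ?; rewrite inE; apply/asboolP.
pose ev (x : n.-tuple A) := [tuple enum_val i x | i < #|U|].
have evE u (uU : u \in U) x : tnth (ev x) (enum_rank_in uU u) = u x.
  by rewrite tnth_mktuple enum_rankK_in.
have ev_inj : injective ev.
  (* The projections are among the coordinates of [ev]. *)
  move=> x y xy; apply: eq_from_tnth => i.
  have pU := UP _ (Cproj n i).
  by have := evE _ pU x; rewrite xy evE !ffunE.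
pose t : operation A #|U| :=
  [ffun z => if [pick x | ev x == z] is Some x then g x else c].
have tE x : t (ev x) = g x.
  rewrite ffunE; case: pickP => [x' /eqP/ev_inj-> //|/(_ x)].
  by rewrite eqxx.
have Ct : C (bundle t).
  apply: PolC; split=> [|s sP] /=.
    by apply/card_gt0P; exists (proj A (Ordinal n0)); apply: UP.
  apply/negPn/negP => /starPn[t_inj t_c].
  (* The default value [c] of [t] matters here: values other than [c] force every row to be some
     [ev (y i)]. *)
  have /choice[y yE] i : exists x, ev x = [tuple s j i | j < #|U|].
    have := t_c i; rewrite ffunE; case: pickP => [x /eqP|]; first by exists x.
    by rewrite eqxx.
  have y_inj : injective y.
    by move=> i j yij; apply: t_inj; rewrite -!yE yij.
  (* The column of [s] at the coordinate of [u] would then lie outside the relation, against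
     [sP]. *)
  have [u /UP uU /negP] := sep y y_inj; apply.
  suff -> : (fun i => u (y i)) = s (enum_rank_in uU u) by [].
  by apply/funext => i; rewrite -(evE _ uU) yE tnth_mktuple.
suff -> : existT _ n g = bundle (comp_op t (fun i => enum_val i)).
  apply: Ccomp => // i; have := enum_valP i.
  by rewrite inE => /asboolP.
by congr existT; apply/ffunP => x; rewrite ffunE tE.
Qed.

Lemma Pol_star_maximal h : 0 < h -> h < #|A| ->
  is_maximal_clone (Pol (@star A c h)).
Proof.
move=> h0 hA; split; first exact: Pol_clone.
  have [f _ nf] := @star_separating h 1 h0 hA isT.
  by move=> PolE; have: O_ A (bundle f) by []; rewrite -PolE => -[].
move=> [C [Ccl [PolC nCPol] [CO nOC]]]; apply: nOC.
have [[m f] Cf nf] : exists2 f, C f & ~ Pol (@star A c h) f.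
  by apply: contra_notP nCPol => nf f Cf; apply: contra_notP nf; exists f.
apply: (clone_with_violation_full Ccl PolC Cf) => fP.
by apply: nf; split=> //; apply: CO Cf.
Qed.

End Star.

Lemma is_chain_imset (I T : finType) (F : I -> {set T}) :
  (forall i j, (F i \subset F j) || (F j \subset F i)) ->
  is_chain [set F i | i : I].
Proof.
move=> FP; apply/forall_inP => _ /imsetP[i _ ->].
by apply/forall_inP => _ /imsetP[j _ ->].
Qed.

Theorem corollary3p4 (k : nat) (A : finType) (hk : 2 <= k)
    (hA : 2 * k + 1 <= #|A|) :
  #|A| - 2 * k <= height (maximal_clone_parts A k).
Proof.
have k0 : 0 < k by exact: ltnW.
have /card_gt0P[c _] : 0 < #|A| by apply: leq_trans hA; rewrite addn1.
pose F i := arity_part k (Pol (@star A c (2 * k + i))).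
have FP i (f : operation A k) :
    reflect (preserves (@star A c (2 * k + i)) f) (f \in F i).
  by rewrite inE; apply: (iffP (asboolP _)) => [[]|].
have F_mono : {homo F : i j / i <= j >-> i \subset j}.
  apply: homo_leq => [i|i j l|i]; [exact: subxx|exact: subset_trans|].
  apply/subsetP => f /FP fP; apply/FP; rewrite addnS.
  by apply: preserves_star_succ fP; apply: leq_addr.
have h0 i : 0 < 2 * k + i by rewrite ltn_addr // muln_gt0.
have hlt (i : 'I_(#|A| - 2 * k)) : 2 * k + i < #|A|.
  by rewrite -ltn_subRL ltn_ord.
pose G (i : 'I_(#|A| - 2 * k)) := F i.
have G_inj : injective G.
  suff lt_neq (i j : 'I_(#|A| - 2 * k)) : i < j -> G i <> G j.
    move=> i j Gij; apply: val_inj.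
    by case: (ltngtP i j) => // /lt_neq; case.
  (* The operation [f] separates the levels [i] and [i.+1]; since [i.+1 <= j], monotonicity carries
     it into [G j]. *)
  move=> lt_ij Gij; have [f fS nf] := star_separating c (h0 i) (hlt i) k0.
  apply: nf; apply/FP; rewrite -/(G i) Gij.
  by apply: (subsetP (F_mono _ _ lt_ij)); apply/FP; rewrite addnS.
have <- : #|[set G i | i : 'I_(#|A| - 2 * k)]| = #|A| - 2 * k.
  by rewrite card_imset // card_ord.
apply: leq_bigmax_cond; apply/andP; split.
  apply/subsetP => _ /imsetP[i _ ->]; rewrite inE; apply/asboolP.
  by exists (Pol (@star A c (2 * k + i))) => //; apply: Pol_star_maximal.
apply: is_chain_imset => i j; case: (leqP i j) => [|/ltnW] ij.
  by rewrite F_mono.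
by rewrite orbC F_mono.
Qed.
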